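(* Fix $n\ge 2$ and a subgroup $B\le\mathcal{S}_n$. Let $(C_m)_{m\ge1}$ and $(A_m)_{m\ge1}$ be sequences of groups such that $C_m\trianglelefteq A_m\le\mathcal{S}_m$ for all $m$. Let $(G_m)_{m\ge1}$ be a sequence of groups such that, for all $m$, $C_m^{[n]}\trianglelefteq G_m\le A_m\wr_P B$ and $\pi_n(G_m)=B$. Suppose there exists a real number $\delta_0$ such that $\lim_{m\to\infty}\delta(C_m a_m)=\delta_0$ for each sequence $(a_m)_{m\ge1}$ of elements $a_m\in A_m$. Then $$\lim_{m\to\infty}\delta(G_m)=1-\frac{1}{|B|}\sum_{\ell=1}^n\genfrac{[}{]}{0pt}{}{B}{\ell}(1-\delta_0)^\ell .$$
   Context: $\mathcal{S}_n$ is the symmetric group on $[n]=\{1,\dots,n\}$; permutations act on the right, $x\mapsto xg$. For a nonempty finite set $C$ of permutations of a finite set (or of elements of a group acting on it), $\delta(C)$ is the proportion of elements of $C$ with no fixed points. Subsets of $\mathcal{S}_m$, such as the coset $C_ma_m$, act on $[m]$. For $B\le\mathcal{S}_n$, $\genfrac{[}{]}{0pt}{}{B}{\ell}$ is the number of elements of $B$ with exactly $\ell$ cycles in their disjoint cycle decomposition (fixed points counted as cycles). For $A\le\mathcal{S}_m$, $B\le\mathcal{S}_n$, the wreath product $A\wr B=A^{[n]}\rtimes B$ has underlying set $A^{[n]}\times B$ ($A^{[n]}$ being the group of functions $[n]\to A$ under pointwise multiplication) and multiplication $(\alpha,b)(\beta,c)=(\alpha\beta^{b^{-1}},bc)$,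 where $\beta^{b}(y)=\beta(yb^{-1})$. $A\wr_P B$ denotes $A\wr B$ acting on the set $[m]^{[n]}$ of functions $\omega\colon[n]\to[m]$ by $(\omega(\alpha,b))(y)=\omega(yb^{-1})\alpha(yb^{-1})$ (power action); its subgroups $G_m$ act on $[m]^{[n]}$ (a set of size $m^n$) by restriction. $\pi_n\colon\mathcal{S}_m\wr_P\mathcal{S}_n\to\mathcal{S}_n$ is the projection $(\alpha,b)\mapsto b$. $C_m^{[n]}$ is the subgroup of $A_m^{[n]}$ of all functions $[n]\to C_m$, identified with $\{(\alpha,1)\mid\alpha\in C_m^{[n]}\}$. *)

(* Defs.v *)
From HB Require Import structures.
From mathcomp Require Import all_boot all_order all_fingroup all_algebra.
From mathcomp Require Import reals.
Set Implicit Arguments.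
Unset Strict Implicit.
Unset Printing Implicit Defensive.
Import Order.TTheory GRing.Theory Num.Theory.

Local Open Scope group_scope.

(* The proportion delta(C); it is only meaningful for nonempty C
   (the value at the empty set is 0 / 0 = 0). *)
Definition derangement_ratio (R : realType) (aT : finGroupType) (rT : finType)
    (to : {action aT &-> rT}) (C : {set aT}) : R :=
  (#|[set g in C | 'Fix_to[g] == set0]|%:R / #|C|%:R)%R.

(* Number of elements of B with exactly l cycles; [porbits b] contains the
   singleton orbits, so fixed points are counted. *)
Definition stirling_group (n : nat) (B : {set 'S_n}) (l : nat) : nat :=
  #|[set b in B | #|porbits b| == l]|.

(* gT^[n] * 'S_n as a record rather than a pair, because the pair type already
   carries the direct-product group structure. *)
Record wreath (gT : finGroupType) (n : nat) : Type :=
  Wreath { wr_fun : {ffun 'I_n -> gT}; wr_perm : 'S_n }.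

Section WreathProduct.
Variables (gT : finGroupType) (n : nat).
Implicit Types (x y z : wreath gT n) (b c : 'S_n) (f g : {ffun 'I_n -> gT}).

Definition wr_pair x := (wr_fun x, wr_perm x).
Definition wr_unpair (p : {ffun 'I_n -> gT} * 'S_n) := Wreath p.1 p.2.
Lemma wr_pairK : cancel wr_pair wr_unpair. Proof. by case. Qed.

HB.instance Definition _ := Finite.copy (wreath gT n) (can_type wr_pairK).

(* f^b *)
Definition wr_shift f b : {ffun 'I_n -> gT} := [ffun i => f (b^-1 i)].

(* (f, b) (g, c) = (f g^(b^-1), b c) *)
Definition wr_mul x y : wreath gT n :=
  Wreath [ffun i => wr_fun x i * wr_shift (wr_fun y) (wr_perm x)^-1 i]
         (wr_perm x * wr_perm y).
Definition wr_one : wreath gT n := Wreath [ffun => 1] 1.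
Definition wr_inv x : wreath gT n :=
  Wreath [ffun i => (wr_shift (wr_fun x) (wr_perm x) i)^-1] (wr_perm x)^-1.

Lemma wr_eq x y : wr_fun x =1 wr_fun y -> wr_perm x = wr_perm y -> x = y.
Proof. by case: x y => [f b] [g c] /= /ffunP -> ->. Qed.

Lemma wr_mulA : associative wr_mul.
Proof.
move=> x y z; apply: wr_eq => [i|] /=; last exact: mulgA.
by rewrite !ffunE !invgK permM mulgA.
Qed.

Lemma wr_mul1 : left_id wr_one wr_mul.
Proof.
move=> x; apply: wr_eq => [i|] /=; last exact: mul1g.
by rewrite !ffunE invgK perm1 mul1g.
Qed.

Lemma wr_mulV : left_inverse wr_one wr_inv wr_mul.
Proof.
move=> x; apply: wr_eq => [i|] /=; last exact: mulVg.
by rewrite !ffunE !invgK mulVg.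
Qed.

HB.instance Definition _ :=
  Finite_isGroup.Build (wreath gT n) wr_mulA wr_mul1 wr_mulV.

Lemma wr_funM x y i : wr_fun (x * y) i = wr_fun x i * wr_fun y (wr_perm x i).
Proof. by rewrite !ffunE invgK. Qed.

Lemma wr_permM x y : wr_perm (x * y) = wr_perm x * wr_perm y.
Proof. by []. Qed.

(* A wr B, as a subgroup of gT wr 'S_n *)
Definition wreath_set (A : {set gT}) (B : {set 'S_n}) : {set wreath gT n} :=
  [set x | [forall i, wr_fun x i \in A] && (wr_perm x \in B)].

Lemma wreath_group_set (A : {group gT}) (B : {group 'S_n}) :
  group_set (wreath_set A B).
Proof.
apply/group_setP; split=> [|x y].
  by rewrite inE group1 andbT; apply/forallP=> i; rewrite ffunE group1.
rewrite !inE => /andP[/forallP Ax Bx] /andP[/forallP Ay By].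
rewrite groupM // andbT; apply/forallP=> i.
by rewrite wr_funM groupM.
Qed.
Canonical wreath_group (A : {group gT}) (B : {group 'S_n}) : {group wreath gT n} :=
  Group (wreath_group_set A B).

(* C^[n], embedded as the pairs (f, 1) with f : [n] -> C *)
Definition wreath_base (C : {set gT}) : {set wreath gT n} :=
  [set Wreath f 1 | f : {ffun 'I_n -> gT} in ffun_on (mem C)].

Lemma mem_wreath_base (C : {set gT}) x :
  (x \in wreath_base C) = [forall i, wr_fun x i \in C] && (wr_perm x == 1).
Proof.
apply/imsetP/andP => [[f /ffun_onP Cf ->]|[/forallP Cx /eqP x1]].
  by split=> //=; apply/forallP.
by exists (wr_fun x); [apply/ffun_onP | apply: wr_eq].
Qed.

Lemma wreath_base_group_set (C : {group gT}) : group_set (wreath_base C).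
Proof.
suff -> : wreath_base C = wreath_set C 1 by apply: wreath_group_set.
by apply/setP=> x; rewrite mem_wreath_base !inE.
Qed.
Canonical wreath_base_group (C : {group gT}) : {group wreath gT n} :=
  Group (wreath_base_group_set C).

Lemma wr_perm_morphM : {in [set: wreath gT n] &, {morph @wr_perm gT n : x y / x * y}}.
Proof. by []. Qed.
Canonical wr_perm_morphism := Morphism wr_perm_morphM.

End WreathProduct.

Section PowerAction.
Variables m n : nat.

Definition power_act (w : {ffun 'I_n -> 'I_m}) (x : wreath 'S_m n) :
    {ffun 'I_n -> 'I_m} :=
  [ffun i => wr_fun x ((wr_perm x)^-1 i) (w ((wr_perm x)^-1 i))].

Lemma power_act1 : power_act^~ 1 =1 id.
Proof. by move=> w; apply/ffunP=> i; rewrite !ffunE /= invg1 !perm1. Qed.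

Lemma power_actM w : act_morph power_act w.
Proof.
move=> x y; apply/ffunP=> i.
by rewrite ffunE wr_permM wr_funM !ffunE invMg !permM permKV.
Qed.

Canonical power_action := TotalAction power_act1 power_actM.

End PowerAction.

(* Main.v *)
(** An element x = (alpha, b) fixes some w : [n] -> [m] iff, for one representative
    r of each cycle of b, the product of alpha along the cycle starting at r has a
    fixed point in [m]: w is determined by its values at the representatives.
    Left multiplication by c in C^[n] supported on the representatives multiplies
    the cycle product a_r by c(r), so averaging over such c shows that 1 - delta(G)
    is the mean over x in G of the products over r of 1 - delta(C a_r).  The
    hypothesis on sequences forces delta(C_m a) -> delta0 uniformly in a in A_m, so
    these products tend uniformly to (1 - delta0)^(number of cycles of b), and b is
    uniform on B when x is uniform on G. *)

Require Import Defs.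
From mathcomp Require Import all_boot all_order all_fingroup all_algebra.
From mathcomp Require Import reals topology normedtype sequences.
Import Order.TTheory GRing.Theory Num.Theory.
Import numFieldNormedType.Exports.
Local Open Scope group_scope.
Local Open Scope classical_set_scope.

(** * Representatives of the cycles of a permutation *)

(** [froot] chooses one canonical point in each cycle, so its fixed points form a transversal. *)
Definition cycle_reps {n : nat} (b : 'S_n) : {set 'I_n} :=
  [set i | froot b i == i].

Lemma porbit_fconnect (n : nat) (b : 'S_n) (i j : 'I_n) :
  (j \in porbit b i) = fconnect b i j.
Proof.
apply/porbitP/idP => [[k ->]|ij]; first by rewrite permX fconnect_iter.
by exists (findex b i j); rewrite permX iter_findex.
Qed.

Lemma card_cycle_reps (n : nat) (b : 'S_n) : #|cycle_reps b| = #|porbits b|.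
Proof.
have symb := fconnect_sym (@perm_inj _ b).
have -> : porbits b = porbit b @: cycle_reps b.
  apply/setP=> S; apply/imsetP/imsetP => -[i iT ->]; last by exists i.
  exists (froot b i); first by rewrite inE (root_root symb).
  by apply/eqP; rewrite eq_porbit_mem porbit_fconnect symb connect_root.
rewrite card_in_imset // => i j; rewrite !inE => /eqP<- /eqP<- /eqP.
by rewrite eq_porbit_mem porbit_fconnect symb => /(fingraph.rootP symb); rewrite !(root_root symb).
Qed.

(** * Cycle products in the wreath product *)

Section CycleProducts.
Context {gT : finGroupType} {n : nat}.
Implicit Types (x : wreath gT n) (f : {ffun 'I_n -> gT}).

(** The base part of a power multiplies the values of [wr_fun x] along the orbit of [r]; the
    exponent is the cycle length. *)
Definition cycle_prod x (r : 'I_n) : gT :=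
  wr_fun (x ^+ fingraph.order (wr_perm x) r) r.

Lemma wr_permX x k : wr_perm (x ^+ k) = wr_perm x ^+ k.
Proof. exact: (morphX (wr_perm_morphism gT n) k (in_setT x)). Qed.

Lemma wr_fun_mem (A : {group gT}) (B : {group 'S_n}) x i :
  x \in wreath_set A B -> wr_fun x i \in A.
Proof. by rewrite inE => /andP[/forallP]. Qed.

Lemma cycle_prod_mem (A : {group gT}) (B : {group 'S_n}) x r :
  x \in wreath_set A B -> cycle_prod x r \in A.
Proof. by move=> xAB; apply: (wr_fun_mem A B); rewrite groupX. Qed.

Definition masked x f : wreath gT n :=
  Wreath [ffun i => if i \in cycle_reps (wr_perm x) then f i else 1] 1.

(** [masked x f] depends on [x] only through [wr_perm x], which multiplication by a base element
    preserves. *)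
Lemma masked_mul_inj f : injective (fun x => masked x f * x).
Proof.
move=> x y /= eqxy.
have bxy: wr_perm x = wr_perm y.
  by move/(congr1 (@wr_perm gT n)): eqxy; rewrite !wr_permM /= !mul1g.
by move: eqxy; rewrite /masked bxy; apply: mulgI.
Qed.

(** The cycle of [r] meets the representatives only at [r], so only the first factor changes. *)
Lemma cycle_prod_masked x f r : r \in cycle_reps (wr_perm x) ->
  cycle_prod (masked x f * x) r = f r * cycle_prod x r.
Proof.
set b := wr_perm x => rT.
set y := masked x f * x.
have by_ : wr_perm y = b by rewrite wr_permM /= mul1g.
have yE i : wr_fun y i = (if i \in cycle_reps b then f i else 1) * wr_fun x i.
  by rewrite wr_funM /= ffunE perm1.
clearbody y.
have off k i : (forall j, j < k -> iter j b i \notin cycle_reps b) ->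
  wr_fun (y ^+ k) i = wr_fun (x ^+ k) i.
  elim: k i => [|k IH] i offi; first by rewrite !expg0.
  rewrite !expgS !wr_funM yE (negPf (offi 0 isT)) mul1g by_ IH // => j jk.
  by rewrite -iterSr; apply: offi.
rewrite /cycle_prod by_ -/b -orderSpred !expgS !wr_funM yE rT by_ -/b mulgA off //.
(* A later representative on the cycle would be its own root, hence [r], but its [findex] from [r]
   is [j.+1], not 0. *)
move=> j jr; rewrite -iterSr inE; apply/negP => /eqP eqr.
have symb := fconnect_sym (@perm_inj _ b).
have jr' : j.+1 < fingraph.order b r by rewrite -orderSpred ltnS.
have : findex b r (iter j.+1 b r) = j.+1 by rewrite findex_iter.
rewrite -eqr -(fingraph.rootP symb (fconnect_iter b j.+1 r)).
by move: rT; rewrite inE => /eqP->; rewrite findex0.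
Qed.

End CycleProducts.

(** * Fixed points of the power action *)

Definition has_fixpoint {aT : finGroupType} {rT : finType}
    (to : {action aT &-> rT}) (g : aT) : bool := 'Fix_to[g] != set0.

Lemma wreath_fix (m n : nat) (x : wreath 'S_m n) :
  has_fixpoint (power_action m n) x =
  [forall r in cycle_reps (wr_perm x),
    has_fixpoint (perm_action 'I_m) (cycle_prod x r)].
Proof.
set b := wr_perm x.
have symb := fconnect_sym (@perm_inj _ b).
have bX k i : wr_perm (x ^+ k) i = iter k b i by rewrite wr_permX permX.
apply/set0Pn/forall_inP => [[w /afix1P wx] r _ | fixr].
  apply/set0Pn; exists (w r); apply/afix1P.
  have : (power_action m n w (x ^+ fingraph.order b r)) = w.
    by elim: (fingraph.order b r) => [|k IH]; rewrite ?expg0 ?act1 // expgSr actM IH.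
  move/ffunP/(_ r); rewrite ffunE /=.
  have -> : (wr_perm (x ^+ fingraph.order b r))^-1 r = r.
    apply: (@perm_inj _ (wr_perm (x ^+ fingraph.order b r))).
    by rewrite permKV bX iter_order //; apply: perm_inj.
  by [].
(* Off the representatives any point will do, but ['I_m] might be empty; the fixed point at the root
   of [i] serves for every [i]. *)
have m_point i : exists p : 'I_m, i \in cycle_reps b -> cycle_prod x i p = p.
  have /set0Pn[p /afix1P /= pfix] :=
    fixr (froot b i) ltac:(by rewrite inE (root_root symb)).
  by exists p; rewrite inE => /eqP rE; move: pfix; rewrite /= rE.
have /fin_all_exists[p pE] := m_point.
have modk k r : r \in cycle_reps b ->
    wr_fun (x ^+ (fingraph.order b r + k)) r (p r) = wr_fun (x ^+ k) r (p r).
  move=> rT; rewrite expgD wr_funM permM bX iter_order; last exact: perm_inj.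
  by rewrite -[wr_fun (x ^+ fingraph.order b r) r]/(cycle_prod x r) pE.
(* The fixed point chosen at each root is transported along its cycle by powers of [x]. *)
exists [ffun i => wr_fun (x ^+ findex b (froot b i) i) (froot b i) (p (froot b i))].
apply/afix1P/ffunP => i; rewrite /= !ffunE.
set j := (_^-1 : 'S_n) i; have -> : i = b j by rewrite permKV.
have -> : froot b (b j) = froot b j.
  by apply/esym/(fingraph.rootP symb); apply: fconnect1.
set r := froot b j.
have rT : r \in cycle_reps b by rewrite inE (root_root symb).
have rj : fconnect b r j by rewrite symb connect_root.
have kE : iter (findex b r j) b r = j by apply: iter_findex.
rewrite -{1}kE -bX -permM -wr_funM -expgSr.
(* If [j] is the last point of its cycle, [b j] is the root again and [modk] absorbs the full
   turn. *)
have := findex_max rj; rewrite leq_eqVlt => /orP[/eqP kmax|klt].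
  have bjr : b j = r.
    by rewrite -{1}kE -iterS kmax iter_order //; apply: perm_inj.
  by rewrite kmax bjr findex0 -[fingraph.order b r]addn0 modk.
by rewrite -{2}kE -iterS findex_iter.
Qed.

(** * Proportions of elements with a fixed point *)

Section FixpointRatio.
Variables (R : realType) (aT : finGroupType) (rT : finType).
Variable to : {action aT &-> rT}.

Lemma derangement_ratioC (C : {set aT}) : C != set0 ->
  (1 - derangement_ratio R to C =
   #|C|%:R^-1 * \sum_(g in C) (has_fixpoint to g)%:R)%R.
Proof.
rewrite -card_gt0 => C0.
have C0R : (#|C|%:R != 0 :> R)%R by rewrite pnatr_eq0 -lt0n.
apply: (mulfI C0R); rewrite mulVKf // mulrBr mulr1 mulrC divfK //.
rewrite -natr_sum; apply/eqP; rewrite subr_eq -natrD eqr_nat; apply/eqP.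
have -> : #|[set g in C | 'Fix_to[g] == set0]| = (\sum_(g in C) ~~ has_fixpoint to g)%N.
  rewrite -sum1dep_card big_mkcondr; apply: eq_bigr => g _.
  by rewrite /has_fixpoint negbK; case: eqP.
by rewrite -big_split -sum1_card /=; apply: eq_bigr => g _; case: has_fixpoint.
Qed.

Lemma derangement_ratio_cosetC (C : {group aT}) (a : aT) :
  (1 - derangement_ratio R to (C :* a) =
   #|C|%:R^-1 * \sum_(c in C) (has_fixpoint to (c * a)%g)%:R)%R.
Proof.
rewrite derangement_ratioC; last first.
  by apply/set0Pn; exists a; apply: rcoset_refl.
rewrite card_rcoset (reindex_inj (mulIg a)) /=; congr (_ * _)%R.
by apply: eq_bigl => c; rewrite mem_rcoset mulgK.
Qed.

Lemma derangement_ratio_ge0 (C : {set aT}) : (0 <= derangement_ratio R to C)%R.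
Proof. by rewrite divr_ge0. Qed.

Lemma derangement_ratio_le1 (C : {set aT}) : (derangement_ratio R to C <= 1)%R.
Proof.
have [->|C0] := eqVneq C set0; first by rewrite /derangement_ratio cards0 invr0 mulr0.
rewrite ler_pdivrMr ?mul1r ?ler_nat ?ltr0n ?card_gt0 //.
by apply: subset_leq_card; apply/subsetP => g; rewrite inE => /andP[].
Qed.

End FixpointRatio.

(* Multiplying by base elements supported on cycle representatives turns each
   cycle product into an independent uniform element of its coset of C. *)
Lemma sum_has_fixpoint (R : realType) (m n : nat) (C : {group 'S_m})
    (G : {group wreath 'S_m n}) : wreath_base n C \subset G ->
  (\sum_(x in G) (has_fixpoint (power_action m n) x)%:R =
   \sum_(x in G) \prod_(r in cycle_reps (wr_perm x))
     (1 - derangement_ratio R (perm_action 'I_m) (C :* cycle_prod x r)))%R.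
Proof.
move=> CG.
pose F x : R := ((has_fixpoint (power_action m n) x)%:R)%R.
have FE x : F x = (\prod_(r in cycle_reps (wr_perm x))
    (has_fixpoint (perm_action 'I_m) (cycle_prod x r))%:R)%R.
  rewrite /F wreath_fix; set ball := [forall (_ | _), _].
  have [/forall_inP fixr|] := boolP ball; first by rewrite big1 // => r /fixr ->.
  rewrite negb_forall_in => /exists_inP[r rT /negPf nfix].
  by rewrite (bigD1 r) //= nfix mul0r.
have C0 : (#|C|%:R ^+ n != 0 :> R)%R by rewrite expf_neq0 // pnatr_eq0 -lt0n cardG_gt0.
apply: (mulfI C0); rewrite -/(F _).
(* For each [f] the map [x] to [masked x f * x] permutes [G], so all [#|C| ^ n] inner sums agree. *)
transitivity (\sum_(f in ffun_on (mem C)) \sum_(x in G) F (masked x f * x)%g)%R.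
  have -> : (\sum_(f in ffun_on (mem C)) \sum_(x in G) F (masked x f * x)%g =
             \sum_(f : {ffun 'I_n -> 'S_m} | f \in ffun_on (mem C)) \sum_(x in G) F x)%R.
    apply: eq_bigr => f /ffun_onP fC; rewrite [RHS](reindex_inj (masked_mul_inj f)) /=.
    apply: eq_bigl => x; rewrite groupMl // (subsetP CG) // mem_wreath_base eqxx andbT.
    by apply/forallP => i; rewrite ffunE; case: ifP.
  by rewrite sumr_const card_ffun_on card_ord -[RHS]mulr_natl natrX.
rewrite exchange_big mulr_sumr; apply: eq_bigr => x _ /=.
set T := cycle_reps (wr_perm x).
(* Padding with 1 off [T] lets the sum over [f] factor over all coordinates; each padded one
   contributes [#|C|]. *)
pose H i (c : 'S_m) : R := if i \in T then
  ((has_fixpoint (perm_action 'I_m) (c * cycle_prod x i)%g)%:R)%R else 1%R.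
transitivity (\sum_(f in ffun_on (mem C)) \prod_i H i (f i))%R.
  apply: eq_bigr => f _; rewrite FE wr_permM mul1g big_mkcond /= -/T.
  by apply: eq_bigr => i _; rewrite /H; case: ifP => // iT; rewrite cycle_prod_masked.
rewrite -(bigA_distr_big (mem C) H) /H.
rewrite [in RHS]big_mkcond -[X in (_ ^+ X)%R]card_ord -prodr_const -big_split /=.
apply: eq_bigr => i _; case: ifP => _; last by rewrite sumr_const mulr1.
rewrite derangement_ratio_cosetC mulVKf //.
by rewrite pnatr_eq0 -lt0n cardG_gt0.
Qed.

(** * Means over groups and comparison of products *)

(** The double sum of [g (f x * y)] is evaluated in both orders, each time removing a
    translation. *)
Lemma mean_morphim (R : realType) (aT rT : finGroupType) (D : {group aT})
    (f : {morphism D >-> rT}) (G : {group aT}) (g : rT -> R) : G \subset D ->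
  (#|G|%:R^-1 * \sum_(x in G) g (f x) =
   #|f @* G|%:R^-1 * \sum_(y in f @* G) g y)%R.
Proof.
move=> GD.
have G0 (hT : finGroupType) (H : {group hT}) : (#|H|%:R != 0 :> R)%R.
  by rewrite pnatr_eq0 -lt0n cardG_gt0.
apply: (mulfI (G0 _ G)); rewrite mulVKf // mulrCA.
apply: (mulfI (G0 _ (f @* G)%G)); rewrite mulVKf //.
transitivity (\sum_(y in f @* G) \sum_(x in G) g (f x * y)%g)%R.
  rewrite mulr_natl -sumr_const; apply: eq_bigr => _ /morphimP[y yD yG ->].
  rewrite (reindex_inj (mulIg y)) /=.
  rewrite (eq_bigl (mem G)) => [|x]; last by rewrite /= groupMr.
  by apply: eq_bigr => x xG; rewrite morphM // (subsetP GD).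
rewrite exchange_big mulr_natl -sumr_const; apply: eq_bigr => x xG /=.
rewrite [RHS](reindex_inj (mulgI (f x))) /=; apply: eq_bigl => y.
by rewrite groupMl // mem_morphim // (subsetP GD).
Qed.

(** Elements are grouped by their number of cycles; [0 < n] gives at least one cycle, so [l] may
    start at 1. *)
Lemma sum_porbits (R : realType) (n : nat) (B : {set 'S_n}) (q : R) : (0 < n)%N ->
  (\sum_(b in B) q ^+ #|porbits b| =
   \sum_(1 <= l < n.+1) (stirling_group B l)%:R * q ^+ l)%R.
Proof.
move=> n0.
transitivity (\sum_(b in B) \sum_(1 <= l < n.+1 | l == #|porbits b|) q ^+ l)%R.
  apply: eq_bigr => b _; rewrite big_nat1_eq.
  rewrite ifT // ltnS; apply/andP; split.
    by rewrite card_gt0; apply/set0Pn; exists (porbit b (Ordinal n0)); apply: imset_f.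
  by rewrite (leq_trans (leq_imset_card _ _)) // card_ord.
rewrite (exchange_big_dep xpredT) //=; apply: eq_bigr => l _.
rewrite sumr_const -[LHS]mulr_natl; congr (_%:R * _)%R.
by apply: eq_card => b; rewrite !inE; congr (_ && _); rewrite eq_sym.
Qed.

Lemma norm_prodB_le (R : realDomainType) (I : Type) (r : seq I) (P : pred I)
    (p q : I -> R) :
  (forall i, P i -> 0 <= p i <= 1)%R -> (forall i, P i -> 0 <= q i <= 1)%R ->
  (`|\prod_(i <- r | P i) p i - \prod_(i <- r | P i) q i| <=
   \sum_(i <- r | P i) `|p i - q i|)%R.
Proof.
move=> p01 q01.
suff [] : (`|\prod_(i <- r | P i) p i - \prod_(i <- r | P i) q i| <=
   \sum_(i <- r | P i) `|p i - q i| /\ 0 <= \prod_(i <- r | P i) q i <= 1)%R by [].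
(* The bound on the partial product of [q] is carried along for the telescoping identity below. *)
apply: (big_rec3 (fun s y x : R => `|x - y| <= s /\ 0 <= y <= 1)%R).
  by rewrite subrr normr0 !lexx ler01.
move=> i s y x Pi [xys /andP[y0 y1]].
have /andP[p0 p1] := p01 i Pi; have /andP[q0 q1] := q01 i Pi.
split; last by rewrite mulr_ge0 // mulr_ile1.
have -> : (p i * x - q i * y = (p i - q i) * y + p i * (x - y))%R.
  by rewrite mulrBl mulrBr [RHS]addrC addrA subrK.
rewrite (le_trans (ler_normD _ _)) // !normrM (ger0_norm y0) (ger0_norm p0).
by rewrite lerD ?ler_piMr // (le_trans (ler_piMl _ p1)).
Qed.

(** * Error estimate and passage to the limit *)

(** Each cycle costs an error of at most [d], and a permutation of [n] points has at most [n]
    cycles. *)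
Lemma wreath_derangement_ratio_dist (R : realType) (m n : nat) (B : {group 'S_n})
    (C A : {group 'S_m}) (G : {group wreath 'S_m n}) (delta0 d : R) :
  (0 < n)%N -> wreath_base n C \subset G -> G \subset wreath_set A B ->
  @wr_perm 'S_m n @: G = B -> (0 <= delta0 <= 1)%R ->
  (forall a, a \in A ->
    `|derangement_ratio R (perm_action 'I_m) (C :* a) - delta0| <= d)%R ->
  (`|derangement_ratio R (power_action m n) G -
     (1 - #|B|%:R^-1 *
       \sum_(1 <= l < n.+1) (stirling_group B l)%:R * (1 - delta0) ^+ l)|
   <= n%:R * d)%R.
Proof.
move=> n0 CG GA GB /andP[d0 d1] ud.
have dge0 : (0 <= d)%R by rewrite (le_trans _ (ud _ (group1 A))).
have q01 : (0 <= 1 - delta0 <= 1)%R by rewrite subr_ge0 d1 gerBl.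
rewrite -sum_porbits //.
(* The mean over [B] is pulled back to [G], so that the two means can be compared term by term. *)
have <- : (wr_perm_morphism 'S_m n) @* G = B by rewrite morphimEsub ?subsetT.
rewrite -(mean_morphim _ _ _ _ _ _ (fun b => (1 - delta0) ^+ #|porbits b|)%R) ?subsetT //=.
rewrite opprB addrCA -[X in `|X|%R]opprK normrN opprD opprB.
rewrite derangement_ratioC; last by apply/set0Pn; exists 1; apply: group1.
rewrite (sum_has_fixpoint _ _ _ C) // addrC -mulrBr -sumrB normrM normfV normr_nat.
have G0 : (0 < #|G|%:R :> R)%R by rewrite ltr0n cardG_gt0.
rewrite ler_pdivrMl // (le_trans (ler_norm_sum _ _ _)) // [leRHS]mulr_natl -sumr_const.
apply: ler_sum => x xG; rewrite -card_cycle_reps -prodr_const.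
apply: le_trans (norm_prodB_le _ _ _ _ _ _ _ _) _ => // [r _|].
  by rewrite subr_ge0 derangement_ratio_le1 gerBl derangement_ratio_ge0.
apply: le_trans (_ : \sum_(r in cycle_reps (wr_perm x)) d <= _)%R.
  apply: ler_sum => r _; rewrite opprB addrC addrA subrK distrC.
  by apply/ud/(cycle_prod_mem A B)/(subsetP GA).
rewrite sumr_const -[leLHS]mulr_natl ler_wpM2r // ler_nat.
by rewrite (leq_trans (max_card _)) ?card_ord.
Qed.

Theorem theorem1p4 (R : realType) (n : nat) (hn : (2 <= n)%N)
    (B : {group 'S_n})
    (C A : forall m : nat, {group 'S_m})
    (hCA : forall m, (0 < m)%N -> C m <| A m)
    (G : forall m : nat, {group wreath 'S_m n})
    (hCG : forall m, (0 < m)%N -> wreath_base n (C m) <| G m)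
    (hGA : forall m, (0 < m)%N -> G m \subset wreath_set (A m) B)
    (hGB : forall m, (0 < m)%N -> @wr_perm 'S_m n @: G m = B)
    (delta0 : R)
    (hdelta : forall a : (forall m : nat, 'S_m),
       (forall m, (0 < m)%N -> a m \in A m) ->
       derangement_ratio R (perm_action 'I_m) (C m :* a m)
         @[m --> \oo] --> delta0) :
  derangement_ratio R (power_action m n) (G m) @[m --> \oo] -->
    (1 - #|B|%:R^-1 *
       \sum_(1 <= l < n.+1) (stirling_group B l)%:R * (1 - delta0) ^+ l)%R.
Proof.
pose u m (a : 'S_m) : R := derangement_ratio R (perm_action 'I_m) (C m :* a).
(* A worst coset for each m turns the hypothesis on sequences into uniformity. *)
pose amax m := [arg max_(a > (1 : 'S_m) in A m) `|u m a - delta0|%R]%O.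
have amaxP m : amax m \in A m /\
    (forall a, a \in A m -> `|u m a - delta0| <= `|u m (amax m) - delta0|)%R.
  by rewrite /amax; case: arg_maxP => // a aA amaxA; split=> // b /amaxA.
have ucvg : u m (amax m) @[m --> \oo] --> delta0.
  by apply: hdelta => m _; case: (amaxP m).
(* A limit of proportions lies in the unit interval, as the comparison of products requires. *)
have d01 : (0 <= delta0 <= 1)%R.
  apply/andP; split.
    by apply: (cvgr_to_ge ucvg); apply: nearW => m; apply: derangement_ratio_ge0.
  by apply: (cvgr_to_le ucvg); apply: nearW => m; apply: derangement_ratio_le1.
apply/subr_cvg0/norm_cvg0P.
apply: (squeeze_cvgr (f := fun=> 0%R)
    (h := fun m => (n%:R * `|u m (amax m) - delta0|)%R)).
- near=> m.
  have m0 : (0 < m)%N by near: m; apply: nbhs_infty_gt.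
  rewrite normr_ge0 /=; apply: (wreath_derangement_ratio_dist _ _ _ _ (C m) (A m)).
  + exact: ltnW.
  + exact: normal_sub (hCG m m0).
  + exact: hGA.
  + exact: hGB.
  + exact: d01.
  + by case: (amaxP m).
- exact: cvg_cst.
- rewrite -[X in _ --> X](mulr0 n%:R)%R; apply: cvgMr.
  exact/norm_cvg0P/subr_cvg0.
Unshelve. all: by end_near.
Qed.
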